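(* Let $n\ge3$ and let $a_1,\dots,a_n$ be pairwise relatively prime integers with $a_k\ge2$ for all $k$. Let $L(\overline{\mathcal P},t)$, for positive integers $t$, be the number of $(m_1,\dots,m_n)\in\mathbb Z^n$ with all $m_k\ge0$ and $\sum_{k=1}^n m_k/a_k\le t$, and let $c_n t^n+\dots+c_1t+c_0$ be the polynomial agreeing with $L(\overline{\mathcal P},t)$ for all positive integers $t$. Put $A=a_1\cdots a_n$, $A_k=A/a_k$, and for $1\le j<k\le n$, $A_{j,k}=A/(a_ja_k)$. Then \[ c_{n-2}=\frac{1}{(n-2)!}\Big(C_n-\mathfrak s(A_1,a_1)-\dots-\mathfrak s(A_n,a_n)\Big), \] where \[ C_n=\frac14\Big(n+\sum_{1\le j<k\le n}A_{j,k}\Big)+\frac1{12}\Big(\frac1A+\frac{A_1}{a_1}+\dots+\frac{A_n}{a_n}\Big). \]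
   Context: $\mathfrak s(a,b)$ is the Dedekind sum: for integers $a$ and $b\ge 1$ with $\gcd(a,b)=1$, $\mathfrak s(a,b)=\frac1{4b}\sum_{k=1}^{b-1}\cot\frac{\pi k a}{b}\cot\frac{\pi k}{b}$ (equivalently $\sum_{k=1}^{b-1}((k/b))((ka/b))$ with $((x))=x-\lfloor x\rfloor-\tfrac12$ for $x\notin\mathbb Z$ and $0$ otherwise). *)

(* Defs.v *)
From HB Require Import structures.
From mathcomp Require Import all_boot all_order all_algebra finmap.
From mathcomp Require Import boolp classical_sets functions cardinality.
From mathcomp Require Import reals trigo.

Set Implicit Arguments.
Unset Strict Implicit.
Unset Printing Implicit Defensive.

Import Order.TTheory GRing.Theory Num.Theory.
Local Open Scope classical_set_scope.
Local Open Scope ring_scope.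

Definition cot (R : realType) (x : R) : R := cos x / sin x.

(* Only meant for [0 < b] and [a] coprime to [b]: then no cotangent below is
   evaluated at a multiple of [pi]. *)
Definition dedekind_sum (R : realType) (a : int) (b : nat) : R :=
  (4 * b%:R)^-1 *
  \sum_(1 <= k < b) cot (pi * k%:R * a%:~R / b%:R) * cot (pi * k%:R / b%:R).

(* Integer points of the dilate by [t] of the closed simplex with vertices 0
   and [a k] times the [k]-th unit vector. *)
Definition simplex_points (n : nat) (a : 'I_n -> nat) (t : nat) :
    set {ffun 'I_n -> int} :=
  [set m | (forall k, 0 <= m k) /\
           \sum_k (m k)%:~R / (a k)%:R <= t%:R :> rat].

(* [fset_set] sends infinite sets to the empty set;
   [finite_simplex_points] shows that this case does not occur. *)
Definition lattice_count (n : nat) (a : 'I_n -> nat) (t : nat) : nat :=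
  #|` fset_set (simplex_points a t)|%fset.

Lemma finite_simplex_points (n : nat) (a : 'I_n -> nat) (t : nat) :
  (forall k, (0 < a k)%N) -> finite_set (simplex_points a t).
Proof.
move=> a_gt0; pose N := (\sum_k t * a k)%N.
pose f (u : {ffun 'I_n -> 'I_N.+1}) : {ffun 'I_n -> int} :=
  [ffun k => (u k : nat)%:Z].
apply: (@sub_finite_set _ _ (f @` setT)); last first.
  exact: finite_image.
move=> m [m_ge0 m_le]; exists [ffun k => inord `|m k|%N] => //.
apply/ffunP => k; rewrite !ffunE inordK; first by rewrite gez0_abs.
rewrite ltnS; apply: (@leq_trans (t * a k)%N); last first.
  by rewrite /N (bigD1 k) //= leq_addr.
have ak_gt0 : (0 : rat) < (a k)%:R by rewrite ltr0n.
have le_k : (m k)%:~R / (a k)%:R <= t%:R :> rat.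
  apply: le_trans m_le; rewrite (bigD1 k) //= lerDl sumr_ge0 // => j _.
  by rewrite divr_ge0 ?ler0z ?ler0n.
move: le_k; rewrite ler_pdivrMr // -natrM -(gez0_abs (m_ge0 k)).
by rewrite -pmulrn ler_nat.
Qed.

Definition prodA (n : nat) (a : 'I_n -> nat) : nat := (\prod_k a k)%N.

Definition prodA1 (n : nat) (a : 'I_n -> nat) (k : 'I_n) : nat :=
  (prodA a %/ a k)%N.

Definition prodA2 (n : nat) (a : 'I_n -> nat) (j k : 'I_n) : nat :=
  (prodA a %/ (a j * a k))%N.

Definition constC (R : realType) (n : nat) (a : 'I_n -> nat) : R :=
  1 / 4 * (n%:R + \sum_(j < n) \sum_(k < n | (j < k)%N) (prodA2 a j k)%:R)
  + 1 / 12 * (1 / (prodA a)%:R + \sum_(k < n) (prodA1 a k)%:R / (a k)%:R).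

(* Main.v *)
Require Import Defs.
From HB Require Import structures.
From mathcomp Require Import all_boot all_order all_algebra.
From mathcomp Require Import reals trigo.
From mathcomp Require Import finmap classical_sets cardinality.
From mathcomp Require Import ring zify.

(** The lattice points [m] of the dilated simplex are sorted by the residue [r]
    of [- \sum_k m_k A_k] modulo [A].  Coprimality makes [r] fix every
    [m_k mod a_k], so the class of [r] consists of the [m_k = j_k + a_k q_k]
    with [q_k >= 0] and [\sum_k q_k <= t - i(r)], where
    [i(r) = r / A + \sum_k j_k / a_k] is an integer between [0] and [n].  Hence
    [L(t) = \sum_(r < A) 'C(t + n - i(r), n)], a polynomial in [t], and
    [(n-2)! c_(n-2)] is half the sum over [r] of
    [(i(r) - (n+1)/2)^2 - (n+1)/12].  The centered summands [j_k / a_k - 1/2]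
    and [r / A - 1/2] of [i(r) - (n+1)/2] have elementary second moments, except
    that pairing [j_k] with [r] gives [1/4 - s(A_k, a_k)], once the cotangent
    sum has been rewritten by finite Fourier analysis. *)

Set Implicit Arguments.
Unset Strict Implicit.
Unset Printing Implicit Defensive.

Import Order.TTheory GRing.Theory Num.Theory.
Local Open Scope ring_scope.

(** * Sums over residues modulo an integer *)

Lemma big_ord_muln (V : nmodType) (a q : nat) (F : nat -> V) :
  \sum_(r < a * q) F r = \sum_(x < a) \sum_(y < q) F (x + a * y)%N.
Proof.
elim: q => [|q IHq].
  by rewrite muln0 big_ord0 big1 // => x _; rewrite big_ord0.
rewrite mulnSr big_split_ord /= IHq -big_split /=.
by apply: eq_bigr => x _; rewrite big_ord_recr /= addnC.
Qed.

(** As [a] is invertible modulo [b], the progression [x + a * y] meets every residue once in each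
    block of [b] consecutive [y]. *)
Lemma sum_affine_modn (V : nmodType) (g : nat -> V) (x a b q : nat) :
  (0 < b)%N -> coprime a b ->
  \sum_(y < b * q) g ((x + a * y) %% b)%N = (\sum_(z < b) g z) *+ q.
Proof.
move=> b_gt0 co_ab; rewrite (big_ord_muln b q (fun y => g ((x + a * y) %% b)%N)).
rewrite exchange_big /=.
rewrite -[RHS]iter_addr_0 -big_const_ord; apply: eq_bigr => y _.
under eq_bigr => z _ do
  rewrite mulnDr mulnCA addnA addnC [(b * _)%N]mulnC modnMDl.
pose h (z : 'I_b) := Ordinal (ltn_pmod (x + a * z) b_gt0).
have h_inj : injective h.
  move=> z z' /(congr1 val) /= /eqP; rewrite eqn_modDl => h_eq.
  apply: val_inj => /=; move: h_eq.
  wlog le_zz : z z' / (z <= z')%N => [W|].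
    by case: (leqP z z') => [/W//|/ltnW/W {}W]; rewrite eq_sym => /W.
  rewrite eq_sym eqn_mod_dvd ?leq_mul2l ?le_zz ?orbT // -mulnBr.
  rewrite Gauss_dvdr 1?coprime_sym // => /dvdnP [[|w]]; first by lia.
  by have := ltn_ord z'; nia.
by rewrite [RHS](reindex_inj h_inj).
Qed.

Lemma dvdn_coprime_addn1 (a v b : nat) : (b %| a * v + 1)%N -> coprime v b.
Proof.
move=> dvd; rewrite /coprime -dvdn1; set g := gcdn v b.
have gv : (g %| a * v)%N by rewrite dvdn_mull // dvdn_gcdl.
by rewrite -(dvdn_addr _ gv) (dvdn_trans (dvdn_gcdr v b)).
Qed.

Lemma sum_natr (R : numFieldType) (N : nat) :
  \sum_(i < N) (i%:R : R) = N%:R * (N%:R - 1) / 2.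
Proof.
elim: N => [|N IHN]; first by rewrite big_ord0 !mul0r.
by rewrite big_ord_recr /= IHN -[N.+1%:R]natr1; field.
Qed.

Lemma sum_natr_sqr (R : numFieldType) (N : nat) :
  \sum_(i < N) (i%:R ^+ 2 : R) = N%:R * (N%:R - 1) * (2 * N%:R - 1) / 6.
Proof.
elim: N => [|N IHN]; first by rewrite big_ord0 !mul0r.
by rewrite big_ord_recr /= IHN -[N.+1%:R]natr1; field.
Qed.

(** The terms at [z] and [m - z] cancel, which leaves the one at [z = 0]: it is -1/2 here, where the
    sawtooth function would be 0. *)
Lemma sum_centered (R : numFieldType) (m : nat) : (0 < m)%N ->
  \sum_(z < m) (z%:R / m%:R - 1 / 2) = - 1 / 2 :> R.
Proof.
move=> m_gt0; have m0 : m%:R != 0 :> R by rewrite pnatr_eq0 -lt0n.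
rewrite sumrB -mulr_suml sum_natr sumr_const card_ord -mulr_natr.
by field.
Qed.

Lemma sum_centered_sqr (R : numFieldType) (m : nat) : (0 < m)%N ->
  \sum_(z < m) (z%:R / m%:R - 1 / 2) ^+ 2 = m%:R / 12 + 1 / (6 * m%:R) :> R.
Proof.
move=> m_gt0; have m0 : m%:R != 0 :> R by rewrite pnatr_eq0 -lt0n.
transitivity (\sum_(z < m) (z%:R ^+ 2 * (m%:R ^+ 2)^-1 - z%:R / m%:R + 1 / 4) : R).
  by apply: eq_bigr => z _; field.
rewrite big_split sumrB /= -!mulr_suml sum_natr sum_natr_sqr sumr_const card_ord.
by rewrite -mulr_natr; field.
Qed.

(** * Trigonometric sums and the Dedekind sum *)

Section Trigonometry.
Context {R : realType}.
Implicit Types (x y : R) (b m N r : nat).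

Lemma sin_2pi_nat m : sin (2 * pi * m%:R) = 0 :> R.
Proof.
elim: m => [|m IHm]; first by rewrite mulr0 sin0.
by rewrite -[m.+1%:R]natr1 mulrDr mulr1 mulr_natl sinD2pi -mulr_natl.
Qed.

Lemma cos_2pi_nat m : cos (2 * pi * m%:R) = 1 :> R.
Proof.
elim: m => [|m IHm]; first by rewrite mulr0 cos0.
by rewrite -[m.+1%:R]natr1 mulrDr mulr1 mulr_natl cosD2pi -mulr_natl.
Qed.

Lemma sin_pi_frac_neq0 b m :
  (0 < b)%N -> ~~ (b %| m)%N -> sin (pi * m%:R / b%:R) != 0 :> R.
Proof.
move=> b_gt0 nbm; rewrite {1}(divn_eq m b) natrD natrM.
have b0 : (b%:R : R) != 0 by rewrite pnatr_eq0 -lt0n.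
set q := (m %/ b)%N; set r := (m %% b)%N.
have -> : pi * (q%:R * b%:R + r%:R) / b%:R = pi * r%:R / b%:R + pi * q%:R :> R.
  by field.
have sin_r : sin (pi * r%:R / b%:R) != 0 :> R.
  rewrite lt0r_neq0 // sin_gt0_pi //; apply/andP; split.
    by rewrite divr_gt0 ?mulr_gt0 ?pi_gt0 ?ltr0n // lt0n.
  rewrite ltr_pdivrMr ?ltr0n // ltr_pM2l ?pi_gt0 // ltr_nat.
  exact: ltn_pmod.
elim: q => [|q IHq]; first by rewrite mulr0 addr0.
by rewrite -[q.+1%:R]natr1 mulrDr mulr1 addrA sinDpi oppr_eq0.
Qed.

(** The factor [2 * sin y] turns each term into a difference of sines, so the sum telescopes; the
    same works for even multiples of [y]. *)
Lemma sum_cos_odd y N :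
  2 * sin y * \sum_(r < N) cos (2 * r%:R * y + y) = sin (2 * N%:R * y).
Proof.
elim: N => [|N IHN]; first by rewrite big_ord0 !(mulr0, mul0r) sin0.
rewrite big_ord_recr /= mulrDr IHN.
have -> : 2 * N.+1%:R * y = (2 * N%:R * y + y) + y by rewrite -[N.+1%:R]natr1; ring.
have -> : 2 * N%:R * y = (2 * N%:R * y + y) - y by ring.
by rewrite subrK sinB [in RHS]sinD; ring.
Qed.

Lemma sum_cos_even y N :
  2 * sin y * \sum_(r < N) cos (2 * r%:R * y) = sin (2 * N%:R * y - y) + sin y.
Proof.
elim: N => [|N IHN].
  by rewrite big_ord0 !(mulr0, mul0r) sub0r sinN addNr.
rewrite big_ord_recr /= mulrDr IHN.
have -> : 2 * N.+1%:R * y - y = 2 * N%:R * y + y by rewrite -[N.+1%:R]natr1; ring.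
by rewrite sinB sinD; ring.
Qed.

(** Summation by parts: [2 * sin y * sin (2 * r%:R * y)] is a difference of cosines at consecutive
    odd multiples of [y]. *)
Lemma sum_natr_sin y N :
  2 * sin y * \sum_(r < N) r%:R * sin (2 * r%:R * y) =
  \sum_(r < N) cos (2 * r%:R * y + y) - N%:R * cos (2 * N%:R * y - y).
Proof.
elim: N => [|N IHN]; first by rewrite !big_ord0 !(mulr0, mul0r) subr0.
rewrite !big_ord_recr /= mulrDr IHN.
have -> : 2 * N.+1%:R * y - y = 2 * N%:R * y + y by rewrite -[N.+1%:R]natr1; ring.
by rewrite cosB cosD -[N.+1%:R]natr1; ring.
Qed.

(** In [sum_natr_sin] at [y = pi * m / b] the cosine sum vanishes and the remaining term is
    [- b * cos y]. *)
Lemma cot_finite_fourier b m : (0 < b)%N -> ~~ (b %| m)%N ->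
  cot (pi * m%:R / b%:R) =
  - (2 / b%:R) * \sum_(r < b) r%:R * sin (2 * pi * m%:R * r%:R / b%:R) :> R.
Proof.
move=> b_gt0 nbm; have b0 : (b%:R : R) != 0 by rewrite pnatr_eq0 -lt0n.
have s0 := sin_pi_frac_neq0 b_gt0 nbm.
set y : R := pi * m%:R / b%:R in s0 *.
have by2 : 2 * b%:R * y = 2 * pi * m%:R by rewrite /y; field.
have ss0 : 2 * sin y != 0 by rewrite mulf_neq0 ?pnatr_eq0.
have D0 : \sum_(r < b) cos (2 * r%:R * y + y) = 0.
  by apply: (mulfI ss0); rewrite sum_cos_odd by2 sin_2pi_nat mulr0.
have := sum_natr_sin y b.
rewrite D0 by2 cosB sin_2pi_nat cos_2pi_nat mul0r addr0 mul1r sub0r => E.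
have -> : \sum_(r < b) r%:R * sin (2 * pi * m%:R * r%:R / b%:R) =
    \sum_(r < b) r%:R * sin (2 * r%:R * y).
  by apply: eq_bigr => r _; congr (_ * sin _); rewrite /y; field.
apply: (mulfI ss0); rewrite [RHS]mulrCA E /cot.
by field; rewrite b0.
Qed.

Lemma sum_cos_2pi_frac b m : (0 < b)%N ->
  \sum_(k < b) cos (2 * pi * k%:R * m%:R / b%:R) =
  (if (b %| m)%N then b%:R else 0) :> R.
Proof.
move=> b_gt0; have b0 : (b%:R : R) != 0 by rewrite pnatr_eq0 -lt0n.
have [/dvdnP [q ->]|nbm] := boolP (b %| m)%N.
  transitivity (\sum_(k < b) (1 : R)); last by rewrite sumr_const card_ord.
  apply: eq_bigr => k _; rewrite -[RHS](cos_2pi_nat (k * q)); congr cos.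
  by rewrite !natrM; field.
have ss0 : 2 * sin (pi * m%:R / b%:R : R) != 0.
  by rewrite mulf_neq0 ?sin_pi_frac_neq0 ?pnatr_eq0.
apply: (mulfI ss0); rewrite mulr0.
have -> : \sum_(k < b) cos (2 * pi * k%:R * m%:R / b%:R : R) =
   \sum_(k < b) cos (2 * k%:R * (pi * m%:R / b%:R)).
  by apply: eq_bigr => k _; congr cos; field.
rewrite sum_cos_even.
have -> : 2 * b%:R * (pi * m%:R / b%:R) = 2 * pi * m%:R :> R by field.
by rewrite sinB sin_2pi_nat cos_2pi_nat; ring.
Qed.

Lemma sum_sin_sin b r s : (0 < b)%N -> (r < b)%N -> (s < b)%N ->
  2 * (\sum_(k < b) sin (2 * pi * k%:R * r%:R / b%:R) *
                    sin (2 * pi * k%:R * s%:R / b%:R)) =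
  (if r == s then b%:R else 0) - (if (b %| r + s)%N then b%:R else 0) :> R.
Proof.
move=> b_gt0 r_lt s_lt.
have b0 : (b%:R : R) != 0 by rewrite pnatr_eq0 -lt0n.
(* [r + (b - s)] stands for [r - s] modulo [b]; the extra [b] shifts the angle by [2 * pi * k],
   which the cosine ignores. *)
have -> : (r == s) = (b %| r + (b - s))%N.
  apply/eqP/idP => [->|/dvdnP [q]]; first by rewrite subnKC // ltnW.
  by case: q => [|[|q]]; nia.
rewrite -!sum_cos_2pi_frac // -sumrB mulr_sumr; apply: eq_bigr => k _.
rewrite (_ : 2 * pi * k%:R * (r + (b - s))%:R / b%:R =
   2 * pi * k%:R * r%:R / b%:R - 2 * pi * k%:R * s%:R / b%:R + 2 * pi * k%:R);
  last by rewrite natrD natrB 1?ltnW //; field.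
rewrite (_ : 2 * pi * k%:R * (r + s)%:R / b%:R =
   2 * pi * k%:R * r%:R / b%:R + 2 * pi * k%:R * s%:R / b%:R);
  last by rewrite natrD; field.
by rewrite [cos (_ + 2 * _ * _)]cosD sin_2pi_nat cos_2pi_nat cosB cosD; ring.
Qed.

(* Expand both cotangents by [cot_finite_fourier]; since [v] is a negative
   inverse of [a], reindexing the second expansion by [s = v * r] turns its
   frequencies [a * s] into [- r], and orthogonality of the sines applies. *)
Lemma dedekind_sumE a b v : (0 < b)%N -> (b %| a * v + 1)%N ->
  dedekind_sum R a%:Z b =
  (b%:R - 1) / 4 - (\sum_(r < b) r%:R * (v * r %% b)%:R) / b%:R ^+ 2.
Proof.
move=> b_gt0 dvd; have b0 : (b%:R : R) != 0 by rewrite pnatr_eq0 -lt0n.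
have co_vb := dvdn_coprime_addn1 dvd.
have co_ab : coprime a b by apply: (@dvdn_coprime_addn1 v); rewrite mulnC.
pose j r := (v * r %% b)%N.
pose S1 (k : nat) : R := \sum_(r < b) r%:R * sin (2 * pi * k%:R * r%:R / b%:R).
pose S2 (k : nat) : R := \sum_(r < b) (j r)%:R * sin (2 * pi * k%:R * r%:R / b%:R).
have S1a k : S1 (k * a)%N = - S2 k.
  have := @sum_affine_modn R
    (fun s => s%:R * sin (2 * pi * (k * a)%:R * s%:R / b%:R)) 0 v b 1 b_gt0 co_vb.
  rewrite muln1 mulr1n /S1 => <-; rewrite /S2 -sumrN.
  apply: eq_bigr => r _; rewrite add0n -/(j r) -mulrN; congr (_ * _).
  have /dvdnP [q Eq] : (b %| a * j r + r)%N.
    rewrite /dvdn -modnDml modnMmr modnDml mulnA -[X in (_ + X)%N]mul1n -mulnDl.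
    exact: dvdn_mulr.
  have -> : 2 * pi * (k * a)%:R * (j r)%:R / b%:R =
     2 * pi * (k * q)%:R - 2 * pi * k%:R * r%:R / b%:R :> R.
    have : ((a * j r + r)%:R : R) = (q * b)%:R by rewrite Eq.
    rewrite natrD !natrM => E; rewrite (_ : r%:R = q%:R * b%:R - a%:R * (j r)%:R).
      by field.
    by rewrite -E; ring.
  by rewrite sinB sin_2pi_nat cos_2pi_nat; ring.
have sumS : \sum_(1 <= k < b) cot (pi * k%:R * a%:Z%:~R / b%:R) *
     cot (pi * k%:R / b%:R) = - (4 / b%:R ^+ 2) * \sum_(k < b) S1 k * S2 k.
  (* Since [S1 0 = 0], the term [k = 0] can be added, and orthogonality needs the full range of
     [k]. *)
  rewrite -(big_mkord xpredT (fun k => S1 k * S2 k)) (big_ltn b_gt0).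
  rewrite (_ : S1 0 = 0) ?mul0r ?add0r; last first.
    by rewrite /S1 big1 // => r _; rewrite !(mulr0, mul0r) sin0 mulr0.
  rewrite mulr_sumr !big_nat; apply: eq_bigr => k /andP [k_gt0 k_lt].
  have nbk : ~~ (b %| k)%N by rewrite gtnNdvd.
  have nbka : ~~ (b %| k * a)%N by rewrite Gauss_dvdl // coprime_sym.
  rewrite -pmulrn -[_ * a%:R]mulrA -natrM !cot_finite_fourier //.
  by rewrite -/(S1 k) -/(S1 (k * a)%N) S1a; field.
have prodS : 2 * (\sum_(k < b) S1 k * S2 k) =
    \sum_(r < b) \sum_(s < b) r%:R * (j s)%:R *
     ((if r == s then b%:R else 0) - (if (b %| r + s)%N then b%:R else 0)).
  under eq_bigr => k _ do rewrite /S1 /S2 mulr_suml.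
  rewrite exchange_big mulr_sumr /=; apply: eq_bigr => r _.
  under eq_bigr => k _ do rewrite mulr_sumr.
  rewrite exchange_big mulr_sumr /=; apply: eq_bigr => s _.
  rewrite -val_eqE -sum_sin_sin ?ltn_ord // !mulr_sumr; apply: eq_bigr => k _.
  ring.
have sumj : \sum_(s < b) ((j s)%:R : R) = b%:R * (b%:R - 1) / 2.
  have := @sum_affine_modn R (fun s => s%:R) 0 v b 1 b_gt0 co_vb.
  by rewrite muln1 mulr1n sum_natr.
have j0 : j 0 = 0%N by rewrite /j muln0 mod0n.
pose S : R := \sum_(r < b) r%:R * (j r)%:R.
(* For fixed [s > 0] only [r = s] and [r = b - s] contribute; for [s = 0] everything vanishes
   because [j 0 = 0]. *)
have prodSE : 2 * (\sum_(k < b) S1 k * S2 k) =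
    2 * b%:R * S - b%:R ^+ 2 * (b%:R * (b%:R - 1) / 2).
  rewrite prodS exchange_big -sumj /S !mulr_sumr -sumrB; apply: eq_bigr => s _.
  rewrite (eq_bigr (fun r : 'I_b => (if r == s then r%:R * (j s)%:R * b%:R else 0)
     - (if (b %| r + s)%N then r%:R * (j s)%:R * b%:R else 0))); last first.
    by move=> r _; case: (r == s); case: (b %| _)%N; ring.
  rewrite sumrB -big_mkcond big_pred1_eq -big_mkcond /=.
  have [s0|s_gt0] := posnP s.
    rewrite s0 j0 big1 => [|r _]; ring.
  have bs_lt : (b - s < b)%N by lia.
  rewrite (big_pred1 (Ordinal bs_lt)) /=; last first.
    move=> r; rewrite /= -val_eqE /=; apply/idP/eqP => [/dvdnP [q]|->].
      by have := ltn_ord r; have := ltn_ord s; case: q => [|[|q]]; nia.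
    by rewrite subnK // ltnW.
  rewrite natrB 1?ltnW //; ring.
rewrite /dedekind_sum sumS -/S.
have -> : \sum_(k < b) S1 k * S2 k =
  (2 * b%:R * S - b%:R ^+ 2 * (b%:R * (b%:R - 1) / 2)) / 2.
  by rewrite -prodSE; field.
by field.
Qed.

End Trigonometry.

(** * Counting lattice points by residue class *)

Section Moduli.
Context {n : nat} (a : 'I_n -> nat).
Hypothesis a_gt0 : forall k, (0 < a k)%N.
Hypothesis a_coprime : forall j k, j != k -> coprime (a j) (a k).
Local Notation A := (prodA a).

Lemma prodA_gt0 : (0 < A)%N.
Proof. exact: prodn_gt0. Qed.

Lemma prodA1E k : prodA1 a k = (\prod_(j | j != k) a j)%N.
Proof. by rewrite /prodA1 /prodA (bigD1 k) //= mulKn. Qed.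

Lemma mul_prodA1 k : (a k * prodA1 a k)%N = A.
Proof. by rewrite prodA1E /prodA [in RHS](bigD1 k). Qed.

Lemma prodA2E j k : j != k ->
  prodA2 a j k = (\prod_(i | (i != j) && (i != k)) a i)%N.
Proof.
move=> jk; rewrite /prodA2 /prodA (bigD1 j) // (bigD1 k) /=; last by rewrite eq_sym.
by rewrite mulnA mulKn // muln_gt0 !a_gt0.
Qed.

Lemma mul_prodA2 j k : j != k -> (a k * prodA2 a j k)%N = prodA1 a j.
Proof.
by move=> jk; rewrite prodA2E // prodA1E [in RHS](bigD1 k) //= eq_sym.
Qed.

Lemma dvdn_prodA1 j k : j != k -> (a j %| prodA1 a k)%N.
Proof. by move=> jk; rewrite prodA1E (bigD1 j) //= dvdn_mulr. Qed.

Lemma coprime_prodA1 k : coprime (a k) (prodA1 a k).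
Proof.
rewrite prodA1E; elim/big_rec: _ => [|j x jk IHx]; first exact: coprimen1.
by rewrite coprimeMr IHx a_coprime // eq_sym.
Qed.

Lemma prodA_dvdn x : (forall k, (a k %| x)%N) -> (A %| x)%N.
Proof.
move=> dvd_x; rewrite /prodA.
(* The induction also carries the coprimality of the partial product with the moduli outside it,
   which [Gauss_dvd] requires. *)
have [] : (\prod_k a k %| x)%N /\
    (forall k, k \notin index_enum 'I_n -> coprime (a k) (\prod_k a k)).
  elim: (index_enum 'I_n) (index_enum_uniq 'I_n) => [|k s IHs] /=.
    by rewrite big_nil => _; split=> // k _; rewrite coprimen1.
  case/andP=> ks /IHs [IH1 IH2]; rewrite big_cons; split.
    by rewrite Gauss_dvd ?dvd_x //; exact: IH2.
  move=> j; rewrite inE negb_or => /andP [jk js].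
  by rewrite coprimeMr a_coprime //= IH2.
by [].
Qed.

Lemma exists_neg_inverses :
  exists v : 'I_n -> nat, forall k, (a k %| prodA1 a k * v k + 1)%N.
Proof.
have Pv k : {v : nat | (a k %| prodA1 a k * v + 1)%N}.
  have [v _] := Bezoutl (prodA1 a k) (a_gt0 k).
  by rewrite (eqP (coprime_prodA1 k)) addnC mulnC; exists v.
by exists (fun k => sval (Pv k)) => k; exact: svalP (Pv k).
Qed.

Variable v : 'I_n -> nat.
Hypothesis v_inv : forall k, (a k %| prodA1 a k * v k + 1)%N.

(* [digit r k] is the residue mod [a k] of the [k]-th coordinate of any lattice
   point [m] with [r + \sum_k m k * prodA1 a k] divisible by [prodA a], and
   [level r] is the ceiling of [\sum_k digit r k / a k] (for [r < prodA a]). *)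
Definition digit (r : nat) (k : 'I_n) : nat := (v k * r %% a k)%N.

Definition level (r : nat) : nat :=
  ((r + \sum_k digit r k * prodA1 a k) %/ A)%N.

(** The division in [level] is exact: modulo [a k] only [r] and the [k]-th summand survive, and they
    add up to a multiple of [prodA1 a k * v k + 1]. *)
Lemma level_mul r : (level r * A)%N = (r + \sum_k digit r k * prodA1 a k)%N.
Proof.
apply: divnK; apply: prodA_dvdn => k.
rewrite (bigD1 k) //= addnA dvdn_addl; last first.
  apply: dvdn_sum => j jk.
  by rewrite dvdn_mull // dvdn_prodA1 // eq_sym.
rewrite /digit /dvdn -modnDmr modnMml modnDmr.
rewrite (_ : (r + _ = (prodA1 a k * v k + 1) * r)%N); last by ring.
exact: dvdn_mulr.
Qed.

(** All of the [n + 1] summands in [level_mul] are below [A]. The bound keeps [n - level r] free of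
    truncation. *)
Lemma level_le r : (r < A)%N -> (level r <= n)%N.
Proof.
move=> r_lt; rewrite -ltnS -(ltn_pmul2r prodA_gt0) level_mul mulSn -addSn.
apply: leq_add => //; rewrite (_ : n * A = \sum_(k < n) A)%N; last first.
  by rewrite sum_nat_const card_ord.
apply: leq_sum => k _; rewrite -(mul_prodA1 k) leq_mul2r.
by rewrite ltnW ?orbT // ltn_pmod.
Qed.

Lemma level_addM r (q : 'I_n -> nat) :
  ((level r + \sum_k q k) * A)%N =
  (r + \sum_k (digit r k + a k * q k) * prodA1 a k)%N.
Proof.
rewrite mulnDl level_mul -addnA; congr addn.
rewrite big_distrl -big_split /=; apply: eq_bigr => k _.
by rewrite -(mul_prodA1 k); ring.
Qed.

Lemma sum_frac_le (m : 'I_n -> nat) t :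
  (\sum_k (m k)%:Z%:~R / (a k)%:R <= t%:R :> rat) =
  (\sum_k m k * prodA1 a k <= t * A)%N.
Proof.
have A0 : (0 : rat) < A%:R by rewrite ltr0n prodA_gt0.
rewrite -(ler_pM2r A0) -natrM -(ler_nat rat) mulr_suml natr_sum.
congr (_ <= _); apply: eq_bigr => k _.
rewrite natrM -pmulrn -(mul_prodA1 k) natrM.
by field; rewrite pnatr_eq0 -lt0n.
Qed.

(** By [level_addM] the weighted sum is [w * A - r] with [w = level r + \sum_k q k], so [w] is its
    quotient by [A] rounded up. *)
Lemma simplex_ineq_level r (q : 'I_n -> nat) t : (r < A)%N ->
  (\sum_k (digit r k + a k * q k) * prodA1 a k <= t * A)%N =
  (level r + \sum_k q k <= t)%N.
Proof.
move=> r_lt; have E := level_addM r q.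
set M := (\sum_k _ * _)%N in E *; set w := (level r + _)%N in E *.
apply/idP/idP => H; last first.
  by rewrite (@leq_trans (w * A)%N) ?leq_mul2r ?H ?orbT // E leq_addl.
rewrite -ltnS -(ltn_pmul2r prodA_gt0) E mulSn.
by rewrite -addSn leq_add.
Qed.

Lemma digit_residue (m : 'I_n -> nat) r k :
  (A %| r + \sum_k m k * prodA1 a k)%N -> (m k %% a k)%N = digit r k.
Proof.
move=> dvdA; have {dvdA} : (a k %| r + m k * prodA1 a k)%N.
  have : (a k %| r + \sum_k m k * prodA1 a k)%N.
    by rewrite (dvdn_trans _ dvdA) // -(mul_prodA1 k) dvdn_mulr.
  rewrite (bigD1 k) //= addnA dvdn_addl //.
  by apply: dvdn_sum => j jk; rewrite dvdn_mull // dvdn_prodA1 // eq_sym.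
(* The added term turns both sides into multiples of [a k]. *)
move=> dvd_k; apply/eqP; rewrite /digit -(eqn_modDr (prodA1 a k * v k * m k)).
have -> : (m k + prodA1 a k * v k * m k = (prodA1 a k * v k + 1) * m k)%N by ring.
have -> : (v k * r + prodA1 a k * v k * m k = (r + m k * prodA1 a k) * v k)%N by ring.
have /eqP -> := dvdn_mulr (m k) (v_inv k).
by have /eqP -> := dvdn_mulr (v k) dvd_k.
Qed.

(** Stars and bars with total at most [t - i], which also bounds every entry; for [t < i] both
    counts are 0. *)
Lemma card_tuple_sum_le t i : (i <= n)%N ->
  #|[pred q : n.-tuple 'I_t.+1 | (i + \sum_k tnth q k <= t)%N]| =
  'C(t + n - i, n).
Proof.
move=> i_le; have [i_gt|i_let] := ltnP t i.
  rewrite bin_small; last by lia.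
  apply: eq_card0 => q; rewrite !inE; apply/negbTE.
  by rewrite -ltnNge (leq_trans i_gt) // leq_addr.
have le_t : ((t - i).+1 <= t.+1)%N by rewrite ltnS leq_subr.
have -> : (t + n - i = n + (t - i))%N by lia.
rewrite -card_partial_ord_partitions.
pose f (q : n.-tuple 'I_(t - i).+1) := map_tuple (widen_ord le_t) q.
have f_inj : injective f.
  move=> q q' /(congr1 val) /= /inj_map E; apply/val_inj/E.
  by move=> x y /(congr1 val) /= xy; exact: val_inj.
rewrite -(card_imset _ f_inj); apply: eq_card => q; rewrite !inE.
apply/idP/imsetP => [q_le|[q' q'_le ->]]; last first.
  move: q'_le; rewrite inE big_tuple => q'_le.
  under eq_bigr => k _ do rewrite tnth_map /=.
  by rewrite -leq_subRL.
have q_lt k : (tnth q k < (t - i).+1)%N.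
  by move: q_le; rewrite (bigD1 k) //=; lia.
exists [tuple Ordinal (q_lt k) | k < n].
  rewrite inE big_tuple; under eq_bigr => k _ do rewrite tnth_mktuple /=.
  by rewrite leq_subRL.
by apply: eq_from_tnth => k; rewrite tnth_map tnth_mktuple; exact: val_inj.
Qed.

Lemma lattice_countE t :
  lattice_count a t = (\sum_(r < A) 'C(t + n - level r, n))%N.
Proof.
pose T := ('I_A * n.-tuple 'I_t.+1)%type.
pose D := [pred p : T | (level p.1 + \sum_k tnth p.2 k <= t)%N].
pose f (p : T) : {ffun 'I_n -> int} :=
  [ffun k => (digit p.1 k + a k * tnth p.2 k)%N%:Z].
have f_inj : injective f.
  move=> [r q] [r' q'] /ffunP E.
  have {}E k : (digit r k + a k * tnth q k = digit r' k + a k * tnth q' k)%N.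
    by have := E k; rewrite !ffunE => -[].
  (* The point determines [r]: adding its weighted sum [M] must give a multiple of [A], and
     [r < A]. *)
  have rr : r = r'.
    have E1 := level_addM r (tnth q); have := level_addM r' (tnth q').
    rewrite -(eq_bigr _ (fun k _ => congr1 (muln^~ (prodA1 a k)) (E k))) => E2.
    set M := (\sum_k _ * _)%N in E1 E2; apply: val_inj => /=.
    apply/eqP; rewrite -(modn_small (ltn_ord r)) -(modn_small (ltn_ord r')).
    by rewrite -(eqn_modDr M) -E1 -E2 !modnMl.
  rewrite -rr in E *; congr pair; apply: eq_from_tnth => k.
  by apply/val_inj/eqP; rewrite -(eqn_pmul2l (a_gt0 k)) -(eqn_add2l (digit r k)) E.
have -> : lattice_count a t = #|` [fset f p | p in D]%fset |.
  congr #|` _|%fset; apply/fsetP => m.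
  rewrite in_fset_set; last exact: finite_simplex_points.
  apply/idP/imfsetP => [|[[r q] /= pD ->]]; rewrite in_setE; last first.
    split=> [k|]; first by rewrite ffunE.
    under eq_bigr => k _ do rewrite ffunE.
    by rewrite sum_frac_le simplex_ineq_level.
  case=> m_ge0 m_le; pose m' k := `|m k|%N.
  have mE k : m k = (m' k)%:Z by rewrite /m' gez0_abs.
  move: m_le; under eq_bigr => k _ do rewrite mE.
  rewrite sum_frac_le => m_le.
  pose M := (\sum_k m' k * prodA1 a k)%N.
  (* [A.-1] acts as -1 modulo [A], so this remainder is the residue of [- M]. *)
  have r_lt : (M * A.-1 %% A < A)%N by rewrite ltn_pmod // prodA_gt0.
  set r := (M * A.-1 %% A)%N in r_lt.
  have dvdA : (A %| r + M)%N.
    rewrite /dvdn /r modnDml -[X in (_ + X)%N]muln1 -mulnDr addn1.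
    by rewrite prednK ?prodA_gt0 // modnMl.
  have m'E k : m' k = (digit r k + a k * (m' k %/ a k))%N.
    by rewrite -(digit_residue _ dvdA) addnC mulnC -divn_eq.
  have le_t : (level r + \sum_k (m' k %/ a k) <= t)%N.
    rewrite -simplex_ineq_level //.
    by under eq_bigr => k _ do rewrite -m'E.
  have q_lt k : (m' k %/ a k < t.+1)%N.
    by move: le_t; rewrite (bigD1 k) //=; lia.
  exists (Ordinal r_lt, [tuple Ordinal (q_lt k) | k < n]) => /=.
    rewrite inE /=; under eq_bigr => k _ do rewrite tnth_mktuple.
    exact: le_t.
  by apply/ffunP => k; rewrite ffunE /= tnth_mktuple mE {1}m'E.
rewrite card_imfset //= -cardE -sum1_card.
rewrite -(pair_big_dep xpredT
  (fun (r : 'I_A) (q : n.-tuple 'I_t.+1) => level r + \sum_k tnth q k <= t)%N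
  (fun _ _ => 1%N)).
apply: eq_bigr => r _; rewrite sum1_card card_tuple_sum_le //.
exact: level_le.
Qed.

Lemma level_natr (R : numFieldType) r :
  (level r)%:R = \sum_k (digit r k)%:R / (a k)%:R + r%:R / A%:R :> R.
Proof.
have A0 : A%:R != 0 :> R by rewrite pnatr_eq0 -lt0n prodA_gt0.
apply: (mulIf A0); rewrite mulrDl divfK // -natrM level_mul natrD addrC.
congr (_ + _); rewrite natr_sum mulr_suml; apply: eq_bigr => k _.
rewrite natrM -(mul_prodA1 k) natrM.
by field; rewrite pnatr_eq0 -lt0n.
Qed.

(** * Equidistribution and independence of the digits *)

Lemma coprime_v k : coprime (v k) (a k).
Proof. exact: dvdn_coprime_addn1 (v_inv k). Qed.

Lemma sum_digit (V : nmodType) (g : nat -> V) k :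
  \sum_(r < A) g (digit r k) = (\sum_(z < a k) g z) *+ prodA1 a k.
Proof.
by rewrite -(sum_affine_modn g 0 _ (a_gt0 k) (coprime_v k)) mul_prodA1.
Qed.

Lemma digitDM x y k : digit (x + a k * y) k = digit x k.
Proof. by rewrite /digit mulnDr mulnCA addnC mulnC modnMDl. Qed.

(** With [r = x + a j * y], the [j]-th digit depends on [x] alone, while [y] moves the [k]-th digit
    through all residues equally often, [v k * a j] being coprime to [a k]. *)
Lemma sum_digitM (R : comPzRingType) (f g : nat -> R) j k : j != k ->
  \sum_(r < A) f (digit r j) * g (digit r k) =
  (prodA2 a j k)%:R * (\sum_(x < a j) f x) * (\sum_(y < a k) g y).
Proof.
move=> jk; rewrite -(mul_prodA1 j).
rewrite (big_ord_muln _ _ (fun r => f (digit r j) * g (digit r k))).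
have -> : \sum_(x < a j) f x = \sum_(x < a j) f (digit x j).
  have := sum_affine_modn f 0 1 (a_gt0 j) (coprime_v j).
  by rewrite muln1 mulr1n.
rewrite -mulrA mulrC -mulrA mulr_suml; apply: eq_bigr => x _.
under eq_bigr => y _ do rewrite digitDM.
rewrite -mulr_sumr; congr (_ * _); rewrite -(mul_prodA2 jk) mulr_natr.
have co : coprime (v k * a j) (a k) by rewrite coprimeMl coprime_v a_coprime.
rewrite -(sum_affine_modn g (v k * x) _ (a_gt0 k) co).
by apply: eq_bigr => y _; rewrite /digit mulnDr mulnA.
Qed.

(** With [r = x + a k * y] the digit depends on [x] alone; the sum left unevaluated is the one in
    [dedekind_sumE]. *)
Lemma sum_mul_digit (R : numFieldType) k :
  \sum_(r < A) r%:R * (digit r k)%:R =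
  (prodA1 a k)%:R * (\sum_(x < a k) x%:R * (digit x k)%:R) +
  (a k)%:R ^+ 2 * ((a k)%:R - 1) * (prodA1 a k)%:R * ((prodA1 a k)%:R - 1) / 4
  :> R.
Proof.
have sumd : \sum_(x < a k) (digit x k)%:R = (a k)%:R * ((a k)%:R - 1) / 2 :> R.
  have := sum_affine_modn (fun z => z%:R : R) 0 1 (a_gt0 k) (coprime_v k).
  by rewrite muln1 mulr1n sum_natr.
rewrite -(mul_prodA1 k).
rewrite (big_ord_muln _ _ (fun r => r%:R * (digit r k)%:R : R)).
transitivity (\sum_(x < a k) ((prodA1 a k)%:R * (x%:R * (digit x k)%:R) +
   (digit x k)%:R * ((a k)%:R * ((prodA1 a k)%:R * ((prodA1 a k)%:R - 1) / 2)))
   : R).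
  apply: eq_bigr => x _; under eq_bigr => y _ do rewrite digitDM natrD natrM.
  rewrite -mulr_suml big_split /= -mulr_sumr sum_natr sumr_const card_ord.
  by rewrite -mulr_natr; ring.
by rewrite big_split /= -mulr_sumr -mulr_suml sumd; field.
Qed.

End Moduli.

(** * The coefficient as a second moment *)

(** The subtraction [x - m] truncates only for [x < m], where the falling factorial is already 0. *)
Lemma ffact_natr (R : comPzRingType) (x m : nat) :
  (x ^_ m)%:R = \prod_(l < m) (x%:R - l%:R) :> R.
Proof.
elim: m => [|m IHm]; first by rewrite big_ord0.
rewrite ffactnSr natrM big_ord_recr /= -IHm.
have [m_le|x_lt] := leqP m x; first by rewrite natrB.
by rewrite ffact_small // !mul0r.
Qed.

(** A nonzero difference would have as many distinct positive integer roots as its size, which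
    exceeds its degree. *)
Lemma eq_poly_pos_nat (R : numDomainType) (p q : {poly R}) :
  (forall t : nat, (0 < t)%N -> p.[t%:R] = q.[t%:R]) -> p = q.
Proof.
move=> pq; apply/eqP; rewrite -subr_eq0; apply/negPn/negP => d0.
pose rs := [seq i%:R : R | i <- iota 1 (size (p - q))].
have: (size rs < size (p - q)%R)%N.
  apply: max_poly_roots d0 _ _.
    apply/allP => _ /mapP [i i_in ->]; rewrite /root hornerD hornerN pq ?subrr //.
    by move: i_in; rewrite mem_iota => /andP [].
  rewrite map_inj_uniq ?iota_uniq // => i j /eqP.
  by rewrite eqr_nat => /eqP.
by rewrite size_map size_iota ltnn.
Qed.

(** * Top coefficients of a product of linear factors *)

Section ElementarySymmetric.
Context {R : comNzRingType} (F : nat -> R).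
Local Notation P m := (\prod_(l < m) ('X + (F l)%:P)).

Lemma coef_prod_XaddC_gt m i : (m < i)%N -> (P m)`_i = 0.
Proof.
elim: m i => [|m IHm] [|i] //= m_lt; first by rewrite big_ord0 coef1.
rewrite big_ord_recr /= mulrDr coefD coefMX coefMC /=.
by rewrite !IHm ?mul0r ?addr0 // ltnW.
Qed.

Lemma coef_prod_XaddC0 m : (P m)`_m = 1.
Proof.
elim: m => [|m IHm]; first by rewrite big_ord0 coef1.
rewrite big_ord_recr /= mulrDr coefD coefMX coefMC /= IHm.
by rewrite coef_prod_XaddC_gt ?mul0r ?addr0.
Qed.

Lemma coef_prod_XaddC1 m : (P m.+1)`_m = \sum_(l < m.+1) F l.
Proof.
elim: m => [|m IHm]; first by rewrite !big_ord1 coefD coefX coefC add0r.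
rewrite big_ord_recr /= mulrDr coefD coefMX coefMC /= IHm coef_prod_XaddC0.
by rewrite mul1r [RHS]big_ord_recr.
Qed.

(** Newton's identity for the second elementary symmetric function of the [F l], kept free of
    division. *)
Lemma coef_prod_XaddC2 m :
  (P m.+2)`_m *+ 2 = (\sum_(l < m.+2) F l) ^+ 2 - \sum_(l < m.+2) F l ^+ 2.
Proof.
elim: m => [|m IHm]; rewrite big_ord_recr /= mulrDr coefD coefMX coefMC /=.
  by rewrite coef_prod_XaddC1 !big_ord_recr !big_ord0 /=; ring.
rewrite coef_prod_XaddC1 mulrnDl IHm.
by rewrite ![\sum_(l < m.+3) _]big_ord_recr /=; ring.
Qed.

End ElementarySymmetric.

Lemma sqr_sum_ord (R : comPzRingType) m (x : 'I_m -> R) :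
  (\sum_k x k) ^+ 2 =
  \sum_k x k ^+ 2 + (\sum_(j < m) \sum_(k < m | (j < k)%N) x j * x k) *+ 2.
Proof.
rewrite expr2 big_distrlr /=.
transitivity (\sum_(i < m) (x i ^+ 2 + (\sum_(k < m | (i < k)%N) x i * x k +
   \sum_(k < m | (k < i)%N) x i * x k))).
  apply: eq_bigr => i _; rewrite (bigD1 i) //= -expr2; congr (_ + _).
  rewrite (bigID (fun k : 'I_m => (i < k)%N)) /=.
  by congr (_ + _); apply: eq_bigl => k; rewrite -val_eqE /=; lia.
rewrite !big_split mulr2n; congr (_ + (_ + _)) => /=.
rewrite (exchange_big_dep xpredT) //=; apply: eq_bigr => i _.
by apply: eq_bigr => k _; rewrite mulrC.
Qed.

(** * Second moments of the centered level *)

Section Moments.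
Context {R : realType} {n : nat} (a v : 'I_n -> nat).
Hypothesis a_gt0 : forall k, (0 < a k)%N.
Hypothesis a_coprime : forall j k, j != k -> coprime (a j) (a k).
Hypothesis v_inv : forall k, (a k %| prodA1 a k * v k + 1)%N.
Local Notation A := (prodA a).
Local Notation X k r := ((digit a v r k)%:R / (a k)%:R - 1 / 2 : R).
Local Notation rho r := (r%:R / A%:R - 1 / 2 : R).

Lemma sum_X_sqr k :
  \sum_(r < A) X k r ^+ 2 = A%:R / 12 + (prodA1 a k)%:R / (6 * (a k)%:R).
Proof.
have a0 : (a k)%:R != 0 :> R by rewrite pnatr_eq0 -lt0n.
rewrite (sum_digit a_gt0 v_inv (fun z => (z%:R / (a k)%:R - 1 / 2) ^+ 2)).
rewrite sum_centered_sqr // -mulr_natr -(mul_prodA1 a_gt0 k) natrM.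
by field.
Qed.

Lemma sum_XX j k : j != k -> \sum_(r < A) X j r * X k r = (prodA2 a j k)%:R / 4.
Proof.
move=> jk; rewrite (sum_digitM a_gt0 a_coprime v_inv
  (fun z => z%:R / (a j)%:R - 1 / 2) (fun z => z%:R / (a k)%:R - 1 / 2) jk).
by rewrite !sum_centered //; field.
Qed.

(** Expanding the product leaves one nonelementary sum, that of [r] times its digit; [sum_mul_digit]
    and [dedekind_sumE] trace it back to the Dedekind sum. *)
Lemma sum_X_rho k :
  \sum_(r < A) X k r * rho r =
  1 / 4 - dedekind_sum R (prodA1 a k)%:Z (a k).
Proof.
have a0 : (a k)%:R != 0 :> R by rewrite pnatr_eq0 -lt0n.
have A1_0 : (prodA1 a k)%:R != 0 :> R.
  have := prodA_gt0 a_gt0; rewrite -(mul_prodA1 a_gt0 k) muln_gt0.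
  by rewrite pnatr_eq0 -lt0n => /andP [].
have A0 : A%:R != 0 :> R by rewrite pnatr_eq0 -lt0n prodA_gt0.
have sumX : \sum_(r < A) X k r = - (prodA1 a k)%:R / 2.
  rewrite (sum_digit a_gt0 v_inv (fun z => z%:R / (a k)%:R - 1 / 2)).
  by rewrite sum_centered // -mulr_natr; field.
transitivity (\sum_(r < A) (r%:R * (digit a v r k)%:R * (A%:R * (a k)%:R)^-1
   - r%:R / (2 * A%:R) - X k r / 2)).
  by apply: eq_bigr => r _; field; rewrite a0 A0.
rewrite !sumrB -!mulr_suml sumX sum_natr sum_mul_digit //.
rewrite (dedekind_sumE (a_gt0 k) (v_inv k)) -(mul_prodA1 a_gt0 k) natrM.
by field; rewrite a0 A1_0.
Qed.

(** [(n + 1) / 2] collects the 1/2 subtracted from each of [n + 1] fractions. Their second moments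
    contain [A / 12] each, and the term [(n + 1) / 12] cancels exactly these. *)
Lemma sum_level_sqr :
  \sum_(r < A) (((level a v r)%:R - (n%:R + 1) / 2) ^+ 2 - (n%:R + 1) / 12) / 2 =
  constC R a - \sum_k dedekind_sum R (prodA1 a k)%:Z (a k).
Proof.
have A0 : A%:R != 0 :> R by rewrite pnatr_eq0 -lt0n prodA_gt0.
have levelE r : (level a v r)%:R - (n%:R + 1) / 2 = \sum_k X k r + rho r.
  rewrite level_natr // sumrB sumr_const card_ord.
  by field.
rewrite -mulr_suml sumrB.
transitivity ((\sum_(r < A) (\sum_k X k r ^+ 2 +
   (\sum_(j < n) \sum_(k < n | (j < k)%N) X j r * X k r) *+ 2 + rho r ^+ 2 +
   (\sum_k X k r * rho r) *+ 2) - \sum_(r < A) (n%:R + 1) / 12) / 2).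
  congr ((_ - _) / _); apply: eq_bigr => r _.
  by rewrite levelE sqrrD sqr_sum_ord mulr_suml; ring.
rewrite !big_split /= sum_centered_sqr ?prodA_gt0 //.
have -> : \sum_(r < A) \sum_(k < n) X k r ^+ 2 =
    \sum_(k < n) (A%:R / 12 + (prodA1 a k)%:R / (6 * (a k)%:R)).
  by rewrite exchange_big; apply: eq_bigr => k _; rewrite -sum_X_sqr.
have -> : \sum_(r < A) \sum_(k < n) X k r * rho r =
    \sum_(k < n) (1 / 4 - dedekind_sum R (prodA1 a k)%:Z (a k)).
  by rewrite exchange_big; apply: eq_bigr => k _; rewrite -sum_X_rho.
have -> : \sum_(r < A) \sum_(j < n) \sum_(k < n | (j < k)%N) X j r * X k r =
    (\sum_(j < n) \sum_(k < n | (j < k)%N) (prodA2 a j k)%:R) / 4.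
  rewrite exchange_big mulr_suml; apply: eq_bigr => j _.
  rewrite exchange_big /= mulr_suml; apply: eq_bigr => k jk.
  by rewrite sum_XX // -val_eqE /= ltn_eqF.
have -> : \sum_(k < n) (A%:R / 12 + (prodA1 a k)%:R / (6 * (a k)%:R)) =
   n%:R * A%:R / 12 + (\sum_(k < n) (prodA1 a k)%:R / (a k)%:R) / 6 :> R.
  rewrite big_split /= sumr_const card_ord mulr_suml.
  congr (_ + _); first by field.
  by apply: eq_bigr => k _; field; rewrite pnatr_eq0 -lt0n.
rewrite sumrB !sumr_const !card_ord /constC.
by field.
Qed.

End Moments.

Theorem theorem7 (R : realType) (n : nat) (hn : (3 <= n)%N) (a : 'I_n -> nat)
    (ha2 : forall k, (2 <= a k)%N)
    (hacop : forall j k, j != k -> coprime (a j) (a k))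
    (c : {poly R}) (hcdeg : (size c <= n.+1)%N)
    (hc : forall t : nat, (0 < t)%N -> c.[t%:R] = (lattice_count a t)%:R) :
  c`_(n - 2) =
    1 / ((n - 2)`!)%:R *
      (constC R a - \sum_(k < n) dedekind_sum R (prodA1 a k)%:Z (a k)).
Proof.
have a_gt0 k : (0 < a k)%N by apply: ltn_trans (ha2 k).
have [v v_inv] := exists_neg_inverses a_gt0 hacop.
have n_fact : n`!%:R != 0 :> R by rewrite pnatr_eq0 -lt0n fact_gt0.
(* Chosen so that ['C(t + n - level r, n)] is the product of the [t + F r l] over [l < n], divided
   by the factorial of [n]. *)
pose F r l : R := (n - level a v r)%:R - l%:R.
have cE : c = n`!%:R^-1 *:
    \sum_(r < prodA a) \prod_(l < n) ('X + (F r l)%:P).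
  apply: eq_poly_pos_nat => t t_gt0.
  rewrite hc // (lattice_countE a_gt0 hacop v_inv).
  rewrite hornerZ horner_sum natr_sum mulr_sumr; apply: eq_bigr => r _.
  apply: (mulfI n_fact); rewrite mulVKf // -natrM mulnC bin_ffact.
  rewrite -addnBA ?level_le // ffact_natr horner_prod; apply: eq_bigr => l _.
  by rewrite hornerD hornerX hornerC natrD /F addrA.
rewrite -(sum_level_sqr a_gt0 hacop v_inv) cE coefZ coef_sum.
have [m nE] : exists m, n = m.+2 by exists (n - 2)%N; lia.
have -> : (n - 2 = m)%N by lia.
rewrite !mulr_sumr; apply: eq_bigr => r _.
have F_sum : \sum_(l < n) F r l =
    n%:R * (n%:R - (level a v r)%:R) - n%:R * (n%:R - 1) / 2.
  rewrite sumrB /= sum_natr sumr_const card_ord natrB ?level_le // -mulr_natr.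
  by ring.
have F_sum2 : \sum_(l < n) F r l ^+ 2 =
    n%:R * (n%:R - (level a v r)%:R) ^+ 2
    - (n%:R - (level a v r)%:R) * n%:R * (n%:R - 1)
    + n%:R * (n%:R - 1) * (2 * n%:R - 1) / 6.
  transitivity (\sum_(l < n) ((n - level a v r)%:R ^+ 2
     - l%:R * (2 * (n - level a v r)%:R) + l%:R ^+ 2) : R).
    by apply: eq_bigr => l _; rewrite /F; ring.
  rewrite big_split sumrB /= sumr_const card_ord -mulr_suml sum_natr sum_natr_sqr.
  by rewrite natrB ?level_le // -mulr_natr; field.
have coefE (G : nat -> R) : (\prod_(l < n) ('X + (G l)%:P))`_m =
    ((\sum_(l < n) G l) ^+ 2 - \sum_(l < n) G l ^+ 2) / 2.
  by rewrite nE -coef_prod_XaddC2 mulr2n; field.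
have factE : n`!%:R = n%:R * (n%:R - 1) * m`!%:R :> R.
  by rewrite nE !factS !natrM -[m.+2%:R]natr1 addrK mulrA.
have m_fact : m`!%:R != 0 :> R by rewrite pnatr_eq0 -lt0n fact_gt0.
have n0 : n%:R != 0 :> R by rewrite pnatr_eq0 nE.
have n1 : n%:R - 1 != 0 :> R by rewrite nE -natr1 addrK pnatr_eq0.
(* With [u = (n + 1) / 2 - level r], the [F r l] sum to [n * u] and their squares to
   [n * u ^ 2 + n * (n ^ 2 - 1) / 12], so the coefficient is
   [n * (n - 1) / 2 * (u ^ 2 - (n + 1) / 12)]. *)
rewrite coefE F_sum F_sum2 factE.
by field; rewrite n0 n1 m_fact.
Qed.
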